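(* Let $(W,S)$ be a finite Coxeter system. Let $v,w\in W$ be such that $v\leq w$. Let $s_{\beta_1}\cdots s_{\beta_\ell}$ be a reduced expression of $w$ and let $m=\ell(v,w)$. For $K\subseteq\{1,\ldots,\ell\}$ let $w_{\hat K}$ denote the product obtained from $s_{\beta_1}\cdots s_{\beta_\ell}$ by omitting the factors $s_{\beta_k}$ with $k\in K$. (1) There exists a unique sequence $1\leq j_1<\cdots<j_m\leq\ell$ such that \[ v=w_{\widehat{\{j_1,\ldots,j_m\}}}\lessdot w_{\widehat{\{j_2,\ldots,j_m\}}}\lessdot\cdots\lessdot w_{\widehat{\{j_m\}}}\lessdot s_{\beta_1}\cdots s_{\beta_\ell}=w, \] where in the $i$th expression ($i=1,\ldots,m+1$) the factors with indices $j_i<\cdots<j_m$ are removed from the reduced expression of $w$. (2) Similarly, there exists a unique sequence $1\leq k_1<\cdots<k_m\leq\ell$ such that \[ v=w_{\widehat{\{k_1,\ldots,k_m\}}}\lessdot w_{\widehat{\{k_1,\ldots,k_{m-1}\}}}\lessdot\cdots\lessdot w_{\widehat{\{k_1\}}}\lessdot s_{\beta_1}\cdots s_{\beta_\ell}=w, \] where in the $i$th expression ($i=1,\ldots,m+1$) the factors with indices $k_1<\cdots<k_{m-i+1}$ are removed from the reduced expression of $w$.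
   Context: $(W,S)$ is a Coxeter system with $W$ finite; the simple reflections in $S$ are written $s_\beta$, indexed by the simple roots $\beta\in\Delta$. $\ell(\cdot)$ is the length function, $\ell(v,w)=\ell(w)-\ell(v)$, $\leq$ is the (strong) Bruhat order on $W$ and $\lessdot$ its covering relation ($u\lessdot u'$ means $u\leq u'$ and $\ell(u,u')=1$). *)

(* Defs.v *)
From HB Require Import structures.
From mathcomp Require Import all_boot all_fingroup.

Set Implicit Arguments.
Unset Strict Implicit.
Unset Printing Implicit Defensive.

Local Open Scope group_scope.

(* A Coxeter system (W, S) with W finite and S = {s_b | b in Delta}: W is the
   group presented by the generators s_b and the relations
   (s_b s_c) ^ m(b, c) = 1.  An entry m(b, c) = 0 stands for infinity, i.e. for
   the absence of a relation (x ^+ 0 = 1 being trivial).  The presentation is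
   expressed by its universal property among all groups; uniqueness of the
   extension follows from cox_gen. *)
Record coxeterSystem (W : finGroupType) (Delta : finType) := CoxeterSystem {
  cox_mx : Delta -> Delta -> nat;
  simple_refl :> Delta -> W;
  cox_mx_sym : forall b c, cox_mx b c = cox_mx c b;
  cox_mx_diag : forall b c, cox_mx b c = 1%N <-> b = c;
  simple_refl_inj : injective simple_refl;
  cox_gen : <<[set simple_refl b | b : Delta]>> = [set: W];
  cox_rel : forall b c,
    (simple_refl b * simple_refl c) ^+ cox_mx b c = 1;
  cox_univ : forall (G : groupType) (f : Delta -> G),
    (forall b c, (f b * f c) ^+ cox_mx b c = 1) ->
    exists phi : {multiplicative W -> G}, forall b, phi (simple_refl b) = f b
}.

Section Coxeter.

Variables (W : finGroupType) (Delta : finType) (s : coxeterSystem W Delta).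

Definition word_prod (l : nat) (b : l.-tuple Delta) : W :=
  \prod_(k < l) s (tnth b k).

Definition word_omit (l : nat) (b : l.-tuple Delta) (K : {set 'I_l}) : W :=
  \prod_(k < l | k \notin K) s (tnth b k).

Definition has_word (x : W) (l : nat) : bool :=
  [exists b : l.-tuple Delta, word_prod b == x].

Lemma has_word_ex (x : W) : exists l, has_word x l.
Proof.
have: x \in <<[set s b | b : Delta]>> by rewrite (cox_gen s) inE.
case/gen_prodgP=> l [c cS ->]; exists l; apply/existsP.
have /fin_all_exists[f fE]: forall k, exists b, s b = c k.
  by move=> k; case/imsetP: (cS k) => b _ ->; exists b.
exists [tuple f k | k < l]; apply/eqP.
by apply: eq_bigr => k _; rewrite tnth_mktuple fE.
Qed.

Definition ell (x : W) : nat := ex_minn (has_word_ex x).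

(* Truncated subtraction: only meaningful for ell v <= ell w, which holds
   whenever v <= w in the Bruhat order. *)
Definition ell2 (v w : W) : nat := ell w - ell v.

Definition reduced_expression (l : nat) (b : l.-tuple Delta) (w : W) : Prop :=
  word_prod b = w /\ l = ell w.

Definition is_reflection (t : W) : bool :=
  [exists b : Delta, exists x : W, t == x * s b * x^-1].

Definition bruhat_step (u u' : W) : bool :=
  [exists t : W, is_reflection t && (u' == u * t)] && (ell u < ell u').

Definition bruhat_le (u u' : W) : bool := connect bruhat_step u u'.

Definition bruhat_cover (u u' : W) : bool :=
  bruhat_le u u' && (ell2 u u' == 1%N).

Definition saturated_chain (m : nat) (v w : W) (c : nat -> W) : Prop :=
  [/\ c 0 = v, forall i, i < m -> bruhat_cover (c i) (c i.+1) & c m = w].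

(* An increasing sequence j_1 < ... < j_m of positions is a tuple sorted for <;
   with expressions numbered from 0, the i-th one omits j_{i+1}, ..., j_m. *)
Definition suffix_omission_chain (l : nat) (b : l.-tuple Delta) (v w : W) (m : nat)
    (j : m.-tuple 'I_l) : Prop :=
  sorted (fun p q : 'I_l => p < q) j /\
  saturated_chain m v w (fun i => word_omit b [set p in drop i j]).

(* With expressions numbered from 0, the i-th one omits k_1, ..., k_{m-i}. *)
Definition prefix_omission_chain (l : nat) (b : l.-tuple Delta) (v w : W) (m : nat)
    (k : m.-tuple 'I_l) : Prop :=
  sorted (fun p q : 'I_l => p < q) k /\
  saturated_chain m v w (fun i => word_omit b [set p in take (m - i) k]).

End Coxeter.

(* Main.v *)
Require Import Defs.
From mathcomp Require Import all_boot all_fingroup.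

(** Write the reduced word of [w] as s_1 ... s_l.  The increasing sequences to
    be found are controlled by a greedy algorithm.  Read the word from left to
    right, starting from tau_0 = v; at the letter s_p put
    tau_p = s_p tau_(p-1) if this is shorter than tau_(p-1) (the letter is
    kept), and tau_p = tau_(p-1) otherwise (the letter is omitted).  The set
    of omitted positions is [greedy v], and the only sequence satisfying (1)
    is the increasing enumeration of this set.

    Uniqueness ([greedy_unique]).  If omitting the letters of [K] yields [v],
    the algorithm reproduces [K] as soon as, for each [p], multiplying on the
    left by s_p lengthens the product of the kept letters beyond [p].  A chain
    as in (1) forces this: lengths along it leave no room for cancellation, so
    each of its words is reduced.  For a kept position the reduced word of [v]
    itself gives the ascent; for an omitted position [p] one uses the word of
    the chain in which [p] has just been restored, which still contains s_p
    followed by the kept letters beyond [p]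
    ([reduced_omission_ascent]).

    Existence.  As v <= w, the lifting property gives tau_l = 1
    ([strip_reduced_le]), so that tau_p is the product of the kept letters
    beyond [p].  The words of the desired chain have the form
    s_1 ... s_p tau_p, and everything rests on their being reduced
    ([ell_mul_strip]).  The reason is a Galois connection.  Let L_s x and
    M_s x be the shorter and the longer of x and s x.  Both are monotone for
    the Bruhat order, M_s (L_s x) >= x, and so tau_p is the least [u] with
    M_(s_1) ... M_(s_p) u >= v.  But M_(s_1) ... M_(s_p) u always equals
    x u' for x = s_1 ... s_p and some u' <= u such that the product x u' is
    length-additive ([raise_additive]); minimality of u = tau_p forces u' = u.

    All the Coxeter combinatorics used comes from one cocycle identity
    ([descentM]) describing when a reflection shortens a product; it is
    obtained from the action of [W] on signed elements, which exists by the
    universal property of the presentation.  Part (2) is part (1) for the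
    reversed word, which represents the inverse of [w]. *)

Set Implicit Arguments.
Unset Strict Implicit.
Unset Printing Implicit Defensive.

(** * Words, length and reflections *)

Section CoxeterTheory.

Local Open Scope group_scope.

Variables (W : finGroupType) (Delta : finType) (s : coxeterSystem W Delta).

Local Notation ell := (ell s).
Local Notation refl := (is_reflection s).

Definition evalw (a : seq Delta) : W := \prod_(c <- a) s c.

Definition reduced (a : seq Delta) : bool := ell (evalw a) == size a.

Lemma evalw_nil : evalw [::] = 1.
Proof. by rewrite /evalw big_nil. Qed.

Lemma evalw_cons c a : evalw (c :: a) = s c * evalw a.
Proof. by rewrite /evalw big_cons. Qed.

Lemma evalw_cat a1 a2 : evalw (a1 ++ a2) = evalw a1 * evalw a2.
Proof. by rewrite /evalw big_cat. Qed.

Lemma word_prodE l (b : l.-tuple Delta) : word_prod s b = evalw b.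
Proof. by rewrite /evalw big_tuple. Qed.

Lemma simple_reflK c : s c * s c = 1.
Proof.
have := cox_rel s c c.
by have [_ ->] := cox_mx_diag s c c.
Qed.

Lemma simple_reflV c : (s c)^-1 = s c.
Proof. by apply/eqP; rewrite eq_invg_mul simple_reflK. Qed.

Lemma simple_reflKl c x : s c * (s c * x) = x.
Proof. by rewrite mulgA simple_reflK mul1g. Qed.

Lemma ell_evalw a : ell (evalw a) <= size a.
Proof.
rewrite /Defs.ell; case: ex_minnP => m _; apply.
by apply/existsP; exists (in_tuple a); rewrite word_prodE.
Qed.

Lemma ell_word x : exists2 a, evalw a = x & size a = ell x.
Proof.
rewrite /Defs.ell; case: ex_minnP => m /existsP[b /eqP <-] _.
by exists b; rewrite ?size_tuple ?word_prodE.
Qed.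

Lemma ell1 : ell 1 = 0.
Proof. by apply/eqP; rewrite -leqn0 -evalw_nil; apply: ell_evalw. Qed.

Lemma ellM x y : ell (x * y) <= ell x + ell y.
Proof.
have [a <- <-] := ell_word x; have [a' <- <-] := ell_word y.
by rewrite -evalw_cat -size_cat ell_evalw.
Qed.

Lemma ell_simple c : ell (s c) <= 1.
Proof. by have := ell_evalw [:: c]; rewrite evalw_cons evalw_nil mulg1. Qed.

Lemma ell_simpleM c x : ell (s c * x) <= (ell x).+1.
Proof.
by apply: leq_trans (ellM _ _) _; rewrite -add1n leq_add2r ell_simple.
Qed.

Lemma evalwV a : (evalw a)^-1 = evalw (rev a).
Proof.
rewrite -[in LHS](revK a) /evalw -prodgV.
by apply: eq_bigr => c _; rewrite simple_reflV.
Qed.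

Lemma ellV x : ell x^-1 = ell x.
Proof.
have leV y : ell y^-1 <= ell y.
  by have [a <- <-] := ell_word y; rewrite evalwV -(size_rev a) ell_evalw.
by apply/eqP; rewrite eqn_leq leV -{1}[x]invgK leV.
Qed.

Lemma refl_simple c : refl (s c).
Proof.
apply/existsP; exists c; apply/existsP; exists 1.
by rewrite mul1g invg1 mulg1.
Qed.

Lemma reflJ t x : refl t -> refl (t ^ x).
Proof.
case/existsP=> c /existsP[y /eqP->].
apply/existsP; exists c; apply/existsP; exists (x^-1 * y).
by rewrite conjgE !invMg invgK !mulgA.
Qed.

Lemma refl_conjP t : refl t -> exists c x, t = s c ^ x.
Proof.
case/existsP=> c /existsP[y /eqP->]; exists c, y^-1.
by rewrite conjgE invgK !mulgA.
Qed.

Lemma reflK t : refl t -> t * t = 1.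
Proof. by case/refl_conjP=> c [x ->]; rewrite -conjMg simple_reflK conj1g. Qed.

Lemma reflV t : refl t -> t^-1 = t.
Proof. by move=> rt; apply/eqP; rewrite eq_invg_mul reflK. Qed.

Lemma reflKl t x : refl t -> t * (t * x) = x.
Proof. by move=> rt; rewrite mulgA reflK // mul1g. Qed.

(** * The reflection cocycle *)

(** The classical action on signed reflections (roots up to scaling): a root
    changes sign under a simple reflection only if it belongs to that
    reflection.  Acting on all of [W] rather than on the reflections alone
    avoids a subtype. *)
Definition signed_act (c : Delta) (p : W * bool) : W * bool :=
  (p.1 ^ s c, p.2 (+) (p.1 == s c)).

Lemma simple_conj_eq c t : (t ^ s c == s c) = (t == s c).
Proof.
have {2}<- : s c ^ s c = s c by rewrite conjgE mulKg.
exact: (inj_eq (@conjg_inj W (s c))).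
Qed.

Lemma signed_actK c : involutive (signed_act c).
Proof.
case=> t e; rewrite /signed_act /= -conjgM simple_reflK conjg1.
by rewrite simple_conj_eq -addbA addbb addbF.
Qed.

Definition signed_perm c : {perm W * bool} := perm (inv_inj (signed_actK c)).

(** In the dihedral group of the involutions [x] and [y], conjugation by [x]
    inverts the rotation [x * y], so that conjugating a reflection by the n-th
    rotation shifts its index by twice n. *)
Lemma conj_rotation (gT : finGroupType) (x y t : gT) n k :
  x * x = 1 -> y * y = 1 ->
  (t ^ ((x * y) ^+ n) == (x * y) ^+ k * x) = (t * x == (x * y) ^+ (n.*2 + k)).
Proof.
move=> xx yy; have Vx : x^-1 = x by apply/eqP; rewrite eq_invg_mul xx.
have Vy : y^-1 = y by apply/eqP; rewrite eq_invg_mul yy.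
have rx : (x * y) ^- n = (x * y) ^+ n ^ x.
  by rewrite conjXg -expgVn invMg Vx Vy conjgE Vx !mulgA xx mul1g.
rewrite (canF_eq (conjgK _)) conjgE invgK -(inj_eq (mulIg x)) rx conjgE Vx.
rewrite -!mulgA xx mulg1 (mulgA x x) xx mul1g -expgD -expgD.
by rewrite -addnn addnAC -addnA.
Qed.

(** By [conj_rotation], the sign flips at the two letters of the n-th factor,
    counted from 0, exactly when [t * s c] is the rotation of exponent 2n, respectively
    2n + 1; hence a single count of exponents below 2n. *)
Lemma signed_perm_pow c d n t e :
  ((signed_perm c * signed_perm d) ^+ n) (t, e) =
  (t ^ ((s c * s d) ^+ n),
   e (+) odd (\sum_(k < n.*2) (t * s c == (s c * s d) ^+ k)%g)).
Proof.
elim: n => [|n IH]; first by rewrite !expg0 perm1 big_ord0 conjg1 addbF.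
rewrite expgSr permM {}IH permM !permE /signed_act /= -!conjgM expgSr mulgA.
rewrite doubleS !big_ord_recr /= !oddD !oddb !addbA.
have cc := simple_reflK c; have dd := simple_reflK d.
congr (_, _ (+) _ (+) _).
  by have := conj_rotation t n 0 cc dd; rewrite expg0 mul1g addn0.
have := conj_rotation t n 1 cc dd; rewrite expg1 addn1 => <-.
by rewrite conjgM (canF_eq (conjgK _)) [s d ^ _]conjgE invgK simple_reflV mulgA.
Qed.

(** Over a full period the exponents run through two identical blocks, so the
    number of flips is even. *)
Lemma signed_perm_rel c d :
  (signed_perm c * signed_perm d) ^+ cox_mx s c d = 1.
Proof.
apply/permP=> -[t e]; rewrite signed_perm_pow perm1 cox_rel conjg1.
congr (_, _); rewrite -addnn big_split_ord /= oddD.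
under [X in _ (+) (_ (+) odd X)]eq_bigr => k _ do rewrite expgD cox_rel mul1g.
by rewrite addbb addbF.
Qed.

(** The sign component of the action of [x] on [t]: it is the parity of the
    number of letters, in any word of [x], at which [t] gets flipped. *)
Lemma reflection_cocycle : exists eta : W -> W -> bool,
  (forall x y t, eta (x * y) t = eta x t (+) eta y (t ^ x)) /\
  (forall c t, eta (s c) t = (t == s c)).
Proof.
have [phi phiE] := cox_univ signed_perm_rel.
have phi1 : phi 1 = 1 by apply: (mulgI (phi 1)); rewrite -gmulfM !mulg1.
pose act (x : W) (p : W * bool) := phi x p.
have act_simple c p : act (s c) p = signed_act c p by rewrite /act phiE permE.
have actM x y p : act (x * y) p = act y (act x p).
  by rewrite /act gmulfM permM.
have actE x t e : act x (t, e) = (t ^ x, e (+) (act x (t, false)).2).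
  have [a <- _] := ell_word x; elim: a t e => [|c a IH] t e.
    by rewrite evalw_nil /act phi1 !perm1 conjg1 addbF.
  rewrite evalw_cons !actM !act_simple /signed_act /= IH [in RHS]IH /=.
  by rewrite conjgM addbA.
exists (fun x t => (act x (t, false)).2); split=> [x y t|c t].
  by rewrite actM (actE x t) [in LHS](actE y).
by rewrite act_simple.
Qed.

(** Strong exchange: an odd number of flips means at least one, and deleting
    the letter at which the first one occurs multiplies by [t] on the left. *)
Lemma cocycle_deletion (eta : W -> W -> bool) :
  (forall x y t, eta (x * y) t = eta x t (+) eta y (t ^ x)) ->
  (forall c t, eta (s c) t = (t == s c)) ->
  forall a t, eta (evalw a) t ->
  exists2 a', size a' < size a & evalw a' = t * evalw a.
Proof.
move=> etaM etaS; elim=> [|c a IH] t.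
  have := etaM 1 1 t; rewrite conjg1 mulg1 addbb evalw_nil => ->//.
rewrite evalw_cons etaM etaS; case: eqP => [-> _|_ /=].
  by exists a => //; rewrite mulgA simple_reflK mul1g.
case/IH=> a' lt_a' a'E; exists (c :: a'); first by [].
by rewrite evalw_cons a'E conjgE simple_reflV !mulgA simple_reflK mul1g.
Qed.

Definition descent t x := ell (t * x) < ell x.

(** If [eta x t] holds, exchange shortens [x].  If not, then [eta (t * x) t]
    holds because [eta t t] does, and exchange shortens [t * x] to [x].  Since
    [eta] is thereby determined by lengths, it can be eliminated in favour of
    [descent]. *)
Lemma descent_is_cocycle : exists eta : W -> W -> bool,
  [/\ forall x y t, eta (x * y) t = eta x t (+) eta y (t ^ x),
      forall c t, eta (s c) t = (t == s c) &
      forall t x, refl t -> descent t x = eta x t].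
Proof.
have [eta [etaM etaS]] := reflection_cocycle.
exists eta; split=> //.
have desc t x : eta x t -> descent t x.
  have [a <- ax] := ell_word x.
  case/(cocycle_deletion etaM etaS)=> a' lt_a' a'E.
  by rewrite /descent -a'E -ax (leq_ltn_trans (ell_evalw _)).
move=> t x rt; have etat : eta t t.
  (* The contributions of the two conjugating factors cancel, and the middle
     simple reflection flips itself. *)
  have [c [y ->]] := refl_conjP rt.
  have := etaM y^-1 y (s c ^ y); rewrite -conjgM mulgV conjg1 mulVg.
  have := etaM 1 1 (s c ^ y); rewrite conjg1 mulg1 addbb => -> e.
  rewrite {1}[s c ^ y]conjgE etaM etaM -conjgM mulgV conjg1 etaS eqxx.
  by rewrite [s c ^ s c]conjgE mulKg addbCA -e.
apply/idP/idP; last exact: desc.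
apply: contraTT => Nxt; rewrite /descent -leqNgt ltnW //.
have : eta (t * x) t by rewrite etaM etat conjgE mulKg (negbTE Nxt).
by move/desc; rewrite /descent reflKl.
Qed.

Lemma descentM t x y : refl t ->
  descent t (x * y) = descent t x (+) descent (t ^ x) y.
Proof.
have [eta [etaM _ etaE]] := descent_is_cocycle.
by move=> rt; rewrite !etaE ?reflJ.
Qed.

Lemma descent_simple t c : refl t -> descent t (s c) = (t == s c).
Proof.
by have [eta [_ etaS etaE]] := descent_is_cocycle => rt; rewrite etaE.
Qed.

Lemma descent_simple_self c : descent (s c) (s c).
Proof. by rewrite descent_simple ?refl_simple. Qed.

Lemma descentMsimple c x : descent (s c) (s c * x) = ~~ descent (s c) x.
Proof.
rewrite descentM ?refl_simple // descent_simple_self.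
by rewrite conjgE mulKg.
Qed.

Lemma ascentN c x : ~~ descent (s c) x -> ell (s c * x) = (ell x).+1.
Proof.
rewrite -descentMsimple /descent simple_reflKl => lt.
by apply/eqP; rewrite eqn_leq ell_simpleM lt.
Qed.

Lemma descent_ell c x : descent (s c) x -> ell x = (ell (s c * x)).+1.
Proof.
move=> dx; have /ascentN : ~~ descent (s c) (s c * x).
  by rewrite descentMsimple negbK.
by rewrite simple_reflKl.
Qed.

(** * Bruhat order and the lifting property *)

Local Notation step := (bruhat_step s).
Local Notation ble := (bruhat_le s).

(** Reflections may equally be multiplied on the left, being stable under
    conjugation. *)
Lemma bruhat_stepP x y :
  reflect (exists2 t, refl t & y = t * x /\ ell x < ell y) (step x y).
Proof.
apply: (iffP andP) => [[/existsP[t /andP[rt /eqP->]] lt]|[t rt [-> lt]]].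
  exists (t ^ x^-1); first exact: reflJ.
  by rewrite [t ^ _]conjgE invgK -!mulgA mulVg mulg1.
split=> //; apply/existsP; exists (t ^ x); rewrite reflJ //=.
by rewrite conjgE !mulgA mulgV mul1g.
Qed.

Lemma ble_refl x : ble x x.
Proof. exact: connect0. Qed.

Lemma ble_trans : transitive ble.
Proof. exact: connect_trans. Qed.

Lemma ble_mul t x : refl t -> ell x < ell (t * x) -> ble x (t * x).
Proof. by move=> rt lt; apply/connect1/bruhat_stepP; exists t. Qed.

Lemma ble_ind (P : W -> W -> Prop) :
  (forall x, P x x) -> (forall x y z, P x y -> P y z -> P x z) ->
  (forall x y, step x y -> P x y) -> forall x y, ble x y -> P x y.
Proof.
move=> P0 Ptr Pstep x y /connectP[p]; elim: p x => [|z p IH] x /= => [_ ->|] //.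
by case/andP=> xz zp yE; apply: Ptr (Pstep _ _ xz) (IH _ zp yE).
Qed.

Lemma ble_ell x y : ble x y -> x = y \/ ell x < ell y.
Proof.
move: x y; apply: ble_ind => [x|x y z|x y /andP[_ lt]]; [by left| |by right].
by case=> [->|xy] // [<-|yz]; right; rewrite // (ltn_trans xy).
Qed.

Lemma ble_leq x y : ble x y -> ell x <= ell y.
Proof. by case/ble_ell=> [->//|/ltnW]. Qed.

Lemma ble_anti x y : ble x y -> ell y <= ell x -> x = y.
Proof. by case/ble_ell=> // lt; rewrite leqNgt lt. Qed.

Lemma bleV x y : ble x y -> ble x^-1 y^-1.
Proof.
move: x y; apply: ble_ind => [x|x y z|x y /bruhat_stepP[t rt [-> lt]]].
- exact: ble_refl.
- exact: ble_trans.
apply/connect1; rewrite /bruhat_step !ellV lt andbT.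
by apply/existsP; exists t; rewrite rt invMg (reflV rt) eqxx.
Qed.

(** L_s and, below, M_s in the notation of the opening comment. *)
Definition lower c x := if descent (s c) x then s c * x else x.

Definition raise c x := if descent (s c) x then x else s c * x.

Lemma lowerP c x :
  lower c x = x \/ lower c x = s c * x.
Proof. by rewrite /lower; case: ifP; [right|left]. Qed.

Lemma ble_ascent c x : ~~ descent (s c) x -> ble x (s c * x).
Proof. by move=> d; apply: ble_mul (refl_simple c) _; rewrite ascentN. Qed.

Lemma ble_descent c x : descent (s c) x -> ble (s c * x) x.
Proof.
rewrite -{1 3}(simple_reflKl c x) descentMsimple; exact: ble_ascent.
Qed.

Lemma lower_le c x : ble (lower c x) x.
Proof.
by rewrite /lower; case: ifP => [/ble_descent|_] //; apply: ble_refl.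
Qed.

Lemma lower_le_mul c x : ble (lower c x) (s c * x).
Proof.
by rewrite /lower; case: ifPn => [_|/ble_ascent] //; apply: ble_refl.
Qed.

Lemma raise_ge c x : ble x (raise c x).
Proof.
by rewrite /raise; case: ifPn => [_|/ble_ascent] //; apply: ble_refl.
Qed.

Lemma raise_ge_mul c x : ble (s c * x) (raise c x).
Proof.
by rewrite /raise; case: ifP => [/ble_descent|_] //; apply: ble_refl.
Qed.

Lemma lower_mul c x : lower c (s c * x) = lower c x.
Proof. by rewrite /lower descentMsimple simple_reflKl; case: descent. Qed.

Lemma raise_mul c x : raise c (s c * x) = raise c x.
Proof. by rewrite /raise descentMsimple simple_reflKl; case: descent. Qed.

(** For a reflection [t] other than [s c], the cocycle identity says that
    [t ^ s c] shortens [s c * y] because [t] shortens [y]. *)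
Lemma step_simple c x y : step x y -> y = s c * x \/ ble (s c * x) (s c * y).
Proof.
case/bruhat_stepP=> t rt [yE lt].
case: (altP (t =P s c)) => [<-|ne_t]; first by left.
have rtc : refl (t ^ s c) by apply: reflJ.
have syE : s c * y = t ^ s c * (s c * x).
  by rewrite yE conjgE simple_reflV -!mulgA simple_reflKl.
have : descent (t ^ s c) (s c * y).
  rewrite descentM // descent_simple // -conjgM simple_reflK conjg1.
  by rewrite simple_conj_eq (negbTE ne_t) /descent yE reflKl // -yE.
right; rewrite syE; apply: ble_mul => //.
by rewrite -{1}(reflKl (s c * x) rtc) -syE.
Qed.

(** The lifting property: left multiplication by [s c] either preserves a
    Bruhat step or swaps its two ends, and [lower c x] lies below both [x] and
    [s c * x]. *)
Lemma lower_homo c x y : ble x y -> ble (lower c x) (lower c y).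
Proof.
move: x y; apply: ble_ind => [x|x y z|x y xy].
- exact: ble_refl.
- exact: ble_trans.
have [->|sxy] := step_simple c xy; first by rewrite lower_mul ble_refl.
have [->|->] := lowerP c y.
  exact: ble_trans (lower_le c x) (connect1 xy).
exact: ble_trans (lower_le_mul c x) sxy.
Qed.

Lemma raise_homo c x y : ble x y -> ble (raise c x) (raise c y).
Proof.
move: x y; apply: ble_ind => [x|x y z|x y xy].
- exact: ble_refl.
- exact: ble_trans.
have [->|sxy] := step_simple c xy; first by rewrite raise_mul ble_refl.
rewrite {1}/raise; case: ifP => _.
  exact: ble_trans (connect1 xy) (raise_ge c y).
exact: ble_trans sxy (raise_ge_mul c y).
Qed.

Lemma le_raise_lower c x : ble x (raise c (lower c x)).
Proof.
have [->|->] := lowerP c x; first exact: raise_ge.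
rewrite raise_mul; exact: raise_ge.
Qed.

(** * Stripping a reduced word off an element *)

(** The greedy state tau after reading the word [a] from [v]. *)
Definition strip v a := foldl (fun x c => lower c x) v a.

Lemma strip_homo a x y : ble x y -> ble (strip x a) (strip y a).
Proof. by elim: a x y => //= c a IH x y /(lower_homo c); apply: IH. Qed.

Lemma reduced_cons c a : reduced (c :: a) ->
  reduced a /\ ~~ descent (s c) (evalw a).
Proof.
rewrite /reduced evalw_cons /= => /eqP e.
have e' : ell (evalw a) = size a.
  apply/eqP; rewrite eqn_leq ell_evalw -ltnS -e; exact: ell_simpleM.
split; first by rewrite e'.
by apply: contra_eqN e' => /descent_ell ->; rewrite e; elim: (size a).
Qed.

Lemma reduced_catl a1 a2 : reduced (a1 ++ a2) -> reduced a1.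
Proof.
rewrite /reduced evalw_cat size_cat => /eqP e; rewrite eqn_leq ell_evalw.
rewrite -(leq_add2r (size a2)) -e (leq_trans (ellM _ _)) // leq_add2l.
exact: ell_evalw.
Qed.

Lemma strip_additive a u : reduced a ->
  ell (evalw a * u) = size a + ell u -> strip (evalw a * u) a = u.
Proof.
elim: a => [|c a IH] /=; first by rewrite evalw_nil mul1g.
case/reduced_cons=> ra _; rewrite evalw_cons -mulgA => e.
have le : ell (evalw a * u) <= size a + ell u.
  by apply: leq_trans (ellM _ _) _; rewrite leq_add2r ell_evalw.
have e' : ell (evalw a * u) = size a + ell u.
  by apply/eqP; rewrite eqn_leq le -ltnS -addSn -e ell_simpleM.
have d : descent (s c) (s c * (evalw a * u)).
  by rewrite /descent simple_reflKl e e'.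
by rewrite {1}/lower d simple_reflKl IH.
Qed.

(** Only a letter [c] failing to lengthen [evalw a * u'] needs care.  It does
    lengthen [evalw a], so by the cocycle identity the reflection
    [t = s c ^ evalw a] shortens [u'].  Then [evalw a * u'] can be rewritten
    as [s c * evalw a * (t * u')], whose lengths must add up since those of
    the original factorisation did. *)
Lemma raise_additive a u : reduced a -> exists u',
  [/\ ble u' u, ell (evalw a * u') = size a + ell u' &
      foldr raise u a = evalw a * u'].
Proof.
elim: a => [|c a IH] /=.
  by exists u; rewrite evalw_nil mul1g ble_refl.
case/reduced_cons=> ra asc; have [u' [u'u add ->]] := IH ra.
rewrite evalw_cons {1}/raise; case: ifPn => [d|nd]; last first.
  by exists u'; rewrite u'u -mulgA ascentN // add.
pose t := s c ^ evalw a; have rt : refl t by apply/reflJ/refl_simple.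
have du' : descent t u'.
  by move: d; rewrite descentM ?refl_simple // (negbTE asc).
have tE : s c * (evalw a * (t * u')) = evalw a * u'.
  by rewrite /t conjgE -!mulgA mulKVg simple_reflKl.
exists (t * u'); rewrite -(mulgA (s c)) tE; split=> //.
  by apply: ble_trans u'u; rewrite -{2}(reflKl u' rt) ble_mul ?reflKl.
apply/eqP; rewrite eqn_leq; apply/andP; split.
  rewrite -{1}tE mulgA -evalw_cons (leq_trans (ellM _ _)) //.
  by rewrite leq_add2r ell_evalw.
by rewrite add addSn -addnS leq_add2l.
Qed.

Lemma strip_le_raise a v : ble v (foldr raise (strip v a) a).
Proof.
elim: a v => [|c a IH] v /=; first exact: ble_refl.
exact: ble_trans (le_raise_lower c v) (raise_homo c (IH _)).
Qed.

(** Let [u <= strip v a] be the additive factor given by [raise_additive].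
    Then [v <= evalw a * u], and stripping [a] from both sides gives
    [strip v a <= u]. *)
Lemma ell_mul_strip a v : reduced a ->
  ell (evalw a * strip v a) = size a + ell (strip v a).
Proof.
move=> ra; have [u [le_u add e]] := raise_additive (strip v a) ra.
have := strip_homo a (strip_le_raise a v); rewrite e strip_additive //.
by move/ble_leq/(ble_anti le_u) => <-.
Qed.

(** Stripping [a] from [evalw a] leaves 1, and stripping is monotone. *)
Lemma strip_reduced_le a v : reduced a -> ble v (evalw a) -> strip v a = 1.
Proof.
move=> ra /(strip_homo a); rewrite -[evalw a]mulg1 strip_additive //.
  by move/ble_anti; apply; rewrite ell1.
by rewrite mulg1 ell1 addn0 (eqP ra).
Qed.

End CoxeterTheory.

(** * Chains that restore the omitted letters from the left *)

(** The default [n] of [nth] makes the filter empty when [i] is past the end. *)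
Lemma drop_sorted_filter (r : seq nat) n i : sorted ltn r -> all (ltn^~ n) r ->
  drop i r = filter (leq (nth n r i)) r.
Proof.
elim: r i => [|x r IH] [|i] //= xr /andP[xn rn].
  rewrite leqnn; congr (_ :: _); apply/esym/all_filterP.
  by apply: sub_all (order_path_min ltn_trans xr) => y; apply: ltnW.
rewrite (IH i (path_sorted xr) rn) leqNgt.
case: (ltnP i (size r)) => [lti|?]; last by rewrite nth_default // xn.
by rewrite (allP (order_path_min ltn_trans xr)) ?mem_nth.
Qed.

Section Subwords.

Local Open Scope group_scope.

Variables (W : finGroupType) (Delta : finType) (s : coxeterSystem W Delta).
Variables (l : nat) (b : l.-tuple Delta).

Local Notation ell := (ell s).
Local Notation ords := (enum 'I_l).
Local Notation lt_ord := (fun p q : 'I_l => p < q).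

(** The list [r] is always a segment of the list of all positions; unlike
    [word_omit], this form can be cut with [take] and [drop]. *)
Definition omit (D : {set 'I_l}) (r : seq 'I_l) : W :=
  \prod_(k <- r | k \notin D) s (tnth b k).

Definition kept (D : {set 'I_l}) (r : seq 'I_l) : nat :=
  count (fun k => k \notin D) r.

Lemma word_omitE D : word_omit s b D = omit D ords.
Proof. by rewrite /word_omit /omit enumT. Qed.

Lemma omit_cat D r1 r2 : omit D (r1 ++ r2) = omit D r1 * omit D r2.
Proof. exact: big_cat. Qed.

Lemma omit_cons D k r :
  omit D (k :: r) = if k \in D then omit D r else s (tnth b k) * omit D r.
Proof. by rewrite /omit big_cons; case: (k \in D). Qed.

Lemma eq_omit (D D' : {set 'I_l}) r : {in r, D =i D'} -> omit D r = omit D' r.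
Proof.
move=> eqD; rewrite /omit -[LHS]big_filter -[RHS]big_filter.
by congr (\prod_(k <- _) _); apply: eq_in_filter => k /eqD->.
Qed.

Lemma ell_omit D r : ell (omit D r) <= kept D r.
Proof.
elim: r => [|k r IH]; first by rewrite /omit big_nil ell1.
rewrite omit_cons /kept /=; case: ifP => _ //.
by rewrite add1n (leq_trans (ell_simpleM _ _ _)).
Qed.

Lemma kept_ords D : kept D ords = l - #|D|.
Proof.
have <- : #|~: D| = kept D ords.
  rewrite -sum1_card /kept -sum1_count enumT.
  by apply: eq_bigl => k; rewrite inE.
by rewrite -[X in X - _](card_ord l) -(cardsC D) addKn.
Qed.

Lemma drop_ords (p : 'I_l) : drop p ords = p :: drop p.+1 ords.
Proof. by rewrite (drop_nth p) ?size_enum_ord // nth_ord_enum. Qed.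

Lemma mem_take_ords n (k : 'I_l) : (k \in take n ords) = (k < n).
Proof. by rewrite in_take ?mem_enum // index_enum_ord. Qed.

Lemma mem_drop_ords n (k : 'I_l) : (k \in drop n ords) = (n <= k).
Proof.
have := enum_uniq 'I_l; rewrite -{1}(cat_take_drop n ords) cat_uniq.
case/and3P=> _ /hasPn dis _; have : k \in ords by rewrite mem_enum.
rewrite -{1}(cat_take_drop n ords) mem_cat mem_take_ords.
have [lt _|//] := ltnP k n; apply/negbTE; apply: contraTN lt => /dis.
by rewrite mem_take_ords.
Qed.

Lemma take_word_rcons (p : 'I_l) : take p.+1 b = rcons (take p b) (tnth b p).
Proof. by rewrite (take_nth (tnth b p)) ?size_tuple // -tnth_nth. Qed.

Lemma omit_take (D : {set 'I_l}) n : (forall k : 'I_l, k < n -> k \notin D) ->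
  omit D (take n ords) = evalw s (take n b).
Proof.
move=> disj; rewrite (@eq_omit _ set0) => [|k]; last first.
  by rewrite mem_take_ords inE => /disj/negbTE.
have bE : b = map (tnth b) ords :> seq _.
  by apply/esym; rewrite -[RHS]map_tnth_enum.
rewrite [in RHS]bE -map_take /evalw big_map /omit.
by apply: eq_bigl => k; rewrite inE.
Qed.

Definition greedy (v : W) : {set 'I_l} :=
  [set p | ~~ descent s (s (tnth b p)) (strip s v (take p b))].

Lemma strip_take_S v (p : 'I_l) :
  strip s v (take p.+1 b) = lower s (tnth b p) (strip s v (take p b)).
Proof. by rewrite take_word_rcons /strip foldl_rcons. Qed.

(** Downward induction on [n], starting from the empty tail: each kept letter
    undoes one length-decreasing step of the stripping. *)
Lemma omit_greedy v n : strip s v b = 1 -> n <= l ->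
  omit (greedy v) (drop n ords) = strip s v (take n b) /\
  ell (strip s v (take n b)) = kept (greedy v) (drop n ords).
Proof.
move=> v1 /subKn <-; elim: (l - n) => [|d IH].
  rewrite subn0 drop_oversize ?size_enum_ord // take_oversize ?size_tuple //.
  by rewrite v1 ell1 /omit big_nil.
have [le_ld|lt_dl] := leqP l d.
  have /eqP e : l - d.+1 == l - d by rewrite (eqP (leqW le_ld)) (eqP le_ld).
  by rewrite e.
pose p := Ordinal (rev_ord_proof (Ordinal lt_dl)).
have pE : p.+1 = l - d by rewrite /= subnSK.
have -> : l - d.+1 = p by [].
move: IH; rewrite -pE drop_ords strip_take_S omit_cons /kept /=.
rewrite inE /lower; case: ifP => /= [dp [-> <-]|_ [-> <-]] //.
by rewrite simple_reflKl (descent_ell dp) add1n.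
Qed.

(** The ascent condition lets the stripping algorithm recover [K]: at a kept
    position [p] the current product starts with the descent s_p, and at an
    omitted one s_p is an ascent. *)
Lemma greedy_unique v (K : {set 'I_l}) : omit K ords = v ->
  (forall p : 'I_l, ~~ descent s (s (tnth b p)) (omit K (drop p.+1 ords))) ->
  K = greedy v.
Proof.
move=> vE asc.
have descE (p : 'I_l) :
    descent s (s (tnth b p)) (omit K (drop p ords)) = (p \notin K).
  rewrite drop_ords omit_cons; case: ifP => _; first exact/negbTE/asc.
  by rewrite descentMsimple asc.
have stripE n : n <= l -> strip s v (take n b) = omit K (drop n ords).
  elim: n => [|n IH] ltn; first by rewrite take0 drop0 vE.
  have := strip_take_S v (Ordinal ltn); rewrite /= => ->.
  rewrite (IH (ltnW ltn)) /lower.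
  have /= -> := descE (Ordinal ltn).
  have /= -> := drop_ords (Ordinal ltn).
  by rewrite omit_cons; case: (_ \in K) => //=; rewrite simple_reflKl.
by apply/setP=> p; rewrite inE stripE 1?ltnW // descE negbK.
Qed.

(** Otherwise s_p and the letters beyond it could be shortened, and the word
    left by omitting [D] would not be reduced. *)
Lemma reduced_omission_ascent (D : {set 'I_l}) (p : 'I_l) :
  ell (word_omit s b D) = l - #|D| -> p \notin D ->
  ~~ descent s (s (tnth b p)) (omit D (drop p.+1 ords)).
Proof.
rewrite word_omitE -kept_ords -{1 2}(cat_take_drop p ords) drop_ords => e pD.
apply/negP; rewrite /descent => lt.
move: e; rewrite omit_cat omit_cons (negbTE pD) /kept count_cat /= pD.
have := ellM s (omit D (take p ords)) (s (tnth b p) * omit D (drop p.+1 ords)).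
move=> le e; move: le; rewrite {}e leqNgt => /negP; apply.
rewrite add1n addnS ltnS leq_add ?ell_omit //.
exact: leq_trans (ltnW lt) (ell_omit _ _).
Qed.

(** Restoring the letters before [n] gives the word s_1 ... s_n tau_n, to
    which [ell_mul_strip] applies. *)
Lemma greedy_suffix_reduced v n : reduced s b -> strip s v b = 1 -> n <= l ->
  ell (word_omit s b [set k in greedy v | n <= k]) =
  l - #|[set k in greedy v | n <= k]|.
Proof.
move=> rb v1 len; set D := [set k in _ | _].
have [eD ellD] := omit_greedy v1 len.
rewrite word_omitE -kept_ords -(cat_take_drop n ords) omit_cat /kept count_cat.
have noD (k : 'I_l) : k < n -> k \notin D.
  by rewrite inE ltnNge => /negbTE->; rewrite andbF.
have eqD : {in drop n ords, D =i greedy v}.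
  by move=> k; rewrite mem_drop_ords inE => ->; rewrite andbT.
rewrite omit_take // (eq_omit eqD) eD ell_mul_strip; last first.
  by apply: (@reduced_catl _ _ _ _ (drop n b)); rewrite cat_take_drop.
rewrite ellD /kept; congr addn; last first.
  by apply: eq_in_count => k /eqD ->.
rewrite (@eq_in_count _ _ predT) => [|k]; last by rewrite mem_take_ords => /noD.
by rewrite count_predT !size_take size_tuple size_enum_ord.
Qed.

Lemma sorted_ords : sorted lt_ord ords.
Proof.
have := iota_ltn_sorted 0 l; rewrite -val_enum_ord sorted_map.
by apply: sub_sorted.
Qed.

Lemma sorted_uniq_ord (r : seq 'I_l) : sorted lt_ord r -> uniq r.
Proof.
apply: sorted_uniq => [y x z|x]; [exact: ltn_trans | exact: ltnn].
Qed.

Lemma eq_sorted_ord (r r' : seq 'I_l) :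
  sorted lt_ord r -> sorted lt_ord r' -> r =i r' -> r = r'.
Proof.
apply: irr_sorted_eq => [y x z|x]; [exact: ltn_trans | exact: ltnn].
Qed.

Lemma drop_sorted_ord (r : seq 'I_l) i : sorted lt_ord r ->
  exists2 n, n <= l & [set k in drop i r] = [set k in [set x in r] | n <= k].
Proof.
move=> sr; have sr' : sorted ltn (map val r) by rewrite sorted_map.
have ltr : all (ltn^~ l) (map val r) by apply/allP=> _ /mapP[k _ ->] /=.
have := drop_sorted_filter i sr' ltr; set n := nth l _ i => e.
exists n.
  rewrite /n; have [lti|?] := ltnP i (size (map val r)).
    exact: ltnW (allP ltr _ (mem_nth l lti)).
  by rewrite nth_default.
apply/setP=> k; rewrite !inE -(mem_map val_inj) map_drop e mem_filter.
by rewrite (mem_map val_inj) andbC.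
Qed.

(** Reinserting a letter [s c] in front of a tail [x] multiplies on the right by
    the reflection [s c ^ x]; as the lengths differ by one this is a cover. *)
Lemma omit_cover (D : {set 'I_l}) (p : 'I_l) : p \notin D ->
  ell (word_omit s b D) = (ell (word_omit s b (p |: D))).+1 ->
  bruhat_cover s (word_omit s b (p |: D)) (word_omit s b D).
Proof.
move=> pD e; rewrite /bruhat_cover /ell2 e subSnn eqxx andbT.
apply/connect1; rewrite /bruhat_step e ltnSn andbT.
rewrite !word_omitE -(cat_take_drop p ords) drop_ords !omit_cat !omit_cons.
rewrite setU11 (negbTE pD).
have ne k : k != p -> (k \in p |: D) = (k \in D) by rewrite !inE => /negbTE->.
have := enum_uniq 'I_l; rewrite -{1}(cat_take_drop p ords) drop_ords cat_uniq.
case/and3P=> _ /hasPn dis /andP[pdr _].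
have -> : omit (p |: D) (take p ords) = omit D (take p ords).
  apply: eq_omit => k kp; apply: ne; apply: contraTneq kp => ->.
  by apply: dis; rewrite inE eqxx.
have -> : omit (p |: D) (drop p.+1 ords) = omit D (drop p.+1 ords).
  by apply: eq_omit => k kp; apply: ne; apply: contraTneq kp => ->.
set x := omit D (drop _ _).
apply/existsP; exists (s (tnth b p) ^ x); rewrite reflJ ?refl_simple //=.
by rewrite conjgE -!mulgA mulKVg.
Qed.

Lemma chain_ell m v w c i : saturated_chain s m v w c -> i <= m ->
  ell (c i) = ell v + i.
Proof.
case=> c0 cov _; elim: i => [|i IH] lti; first by rewrite c0 addn0.
have /andP[_] := cov i lti; rewrite /ell2 (IH (ltnW lti)) => /eqP e.
have lt : 0 < ell (c i.+1) - (ell v + i) by rewrite e.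
rewrite addnS -(addn1 (_ + _)) -e subnKC //.
by rewrite subn_gt0 in lt; apply: ltnW.
Qed.

(** The two directions are uniqueness and existence in (1): a chain satisfies
    the ascent condition of [greedy_unique], and the greedy set yields words
    of the right lengths by [greedy_suffix_reduced]. *)
Lemma suffix_omission_chainE m v w (j : m.-tuple 'I_l) :
  reduced_expression s b w -> bruhat_le s v w -> m = ell2 s v w ->
  suffix_omission_chain s b v w j <->
  sorted lt_ord j /\ [set k in j] = greedy v.
Proof.
move=> [bw lw] vw mE.
have wE : evalw s b = w by rewrite -word_prodE.
have rb : reduced s b by rewrite /reduced wE -lw size_tuple.
have v1 : strip s v b = 1 by apply: strip_reduced_le; rewrite ?wE.
have lv : ell v + m = l by rewrite mE /ell2 -lw subnKC // lw ble_leq.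
have cardj i : sorted lt_ord j -> #|[set k in drop i j]| = m - i.
  move=> sj; rewrite cardsE.
  have/card_uniqP-> := drop_uniq i (sorted_uniq_ord sj).
  by rewrite size_drop size_tuple.
split=> -[sj].
  move=> ch; split=> //.
  have red i : i <= m -> ell (word_omit s b [set k in drop i j]) =
      l - #|[set k in drop i j]|.
    move=> lei; rewrite cardj // (chain_ell ch lei).
    by rewrite -lv -addnBA ?leq_subr // subKn.
  apply: greedy_unique.
    by case: ch => <- _ _; rewrite drop0 word_omitE.
  move=> p; have [pj|pj] := boolP (p \in j); last first.
    apply: reduced_omission_ascent; last by rewrite inE.
    by have := red 0 isT; rewrite drop0.
  (* For an omitted p, take the word of the chain in which p and all smaller
     positions are restored. *)
  have lti : index p j < m by rewrite -{2}(size_tuple j) index_mem.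
  have jE : drop (index p j) j = p :: drop (index p j).+1 j.
    by rewrite (drop_nth p) ?index_mem // nth_index.
  have pD : p \notin [set k in drop (index p j).+1 j].
    have := drop_uniq (index p j) (sorted_uniq_ord sj).
    by rewrite jE inE => /andP[].
  have -> : omit [set k in j] (drop p.+1 ords) =
      omit [set k in drop (index p j).+1 j] (drop p.+1 ords).
    apply: eq_omit => k; rewrite mem_drop_ords => ltpk.
    have [n _ /setP e] := drop_sorted_ord (index p j) sj.
    have := e p; have := e k; rewrite !inE jE !inE eqxx pj /= => ek lenp.
    by move: ek; rewrite -val_eqE gtn_eqF // (leq_trans _ ltpk) 1?andbT // ltnW.
  exact: reduced_omission_ascent (red _ lti) pD.
move=> jg; split=> //.
have red i : ell (word_omit s b [set k in drop i j]) =
    l - #|[set k in drop i j]|.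
  by have [n len ->] := drop_sorted_ord i sj; rewrite jg greedy_suffix_reduced.
have redE i : i <= m -> ell (word_omit s b [set k in drop i j]) = ell v + i.
  by move=> lei; rewrite red cardj // -lv -addnBA ?leq_subr // subKn.
split; last first.
- rewrite drop_oversize ?size_tuple // -wE word_omitE.
  rewrite -[ords](take_oversize (n := l)) ?size_enum_ord // omit_take.
    by rewrite take_oversize ?size_tuple.
  by move=> k _; rewrite !inE.
- move=> i lti.
  have p0 : 'I_l by case: (j) lti => -[|? ?] //= /eqP <-.
  have jE : drop i j = nth p0 j i :: drop i.+1 j.
    by rewrite (drop_nth p0) ?size_tuple.
  have DE : [set k in drop i j] = nth p0 j i |: [set k in drop i.+1 j].
    by apply/setP=> k; rewrite jE !inE.
  rewrite DE; apply: omit_cover; last by rewrite -DE !redE ?addnS // ltnW.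
  have := drop_uniq i (sorted_uniq_ord sj).
  by rewrite jE inE => /andP[].
- rewrite drop0 word_omitE jg.
  by have [] := omit_greedy v1 (leq0n l); rewrite drop0 take0.
Qed.

Lemma suffix_chain_exists_unique v w m :
  reduced_expression s b w -> bruhat_le s v w -> m = ell2 s v w ->
  exists! j : m.-tuple 'I_l, suffix_omission_chain s b v w j.
Proof.
move=> bw vw mE.
have chE := suffix_omission_chainE _ bw vw mE.
have [bE lw] := bw; have wE : evalw s b = w by rewrite -word_prodE.
have rb : reduced s b by rewrite /reduced wE -lw size_tuple.
have v1 : strip s v b = 1 by apply: strip_reduced_le; rewrite ?wE.
have szE : size (enum (greedy v)) == m.
  have [e0] := omit_greedy v1 (leq0n l).
  rewrite take0 drop0 kept_ords mE /ell2 -lw /= => ->.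
  by rewrite subKn -?cardE // -[X in _ <= X](card_ord l) max_card.
have sg : sorted lt_ord (enum (greedy v)).
  rewrite /enum_mem -enumT.
  by apply: sorted_filter sorted_ords => y x z; apply: ltn_trans.
exists (Tuple szE); split=> [|j' /chE[sj' j'E]].
  by apply/chE; split=> //; apply/setP=> k; rewrite inE mem_enum.
apply/val_inj/eq_sorted_ord => //= k.
by rewrite mem_enum -j'E inE.
Qed.

End Subwords.

(** * Reversal of words *)

Section Reversal.

Local Open Scope group_scope.

Variables (W : finGroupType) (Delta : finType) (s : coxeterSystem W Delta).
Variables (l : nat) (b : l.-tuple Delta).

Local Notation ords := (enum 'I_l).
Local Notation lt_ord := (fun p q : 'I_l => p < q).

Definition flip_word : l.-tuple Delta := [tuple tnth b (rev_ord k) | k < l].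

Definition flip m (j : m.-tuple 'I_l) : m.-tuple 'I_l :=
  [tuple of rev (map (@rev_ord l) j)].

Lemma flipK m : involutive (@flip m).
Proof.
by move=> j; apply: val_inj; rewrite /= map_rev revK (mapK rev_ordK).
Qed.

Lemma sorted_flip (r : seq 'I_l) :
  sorted lt_ord (rev (map (@rev_ord l) r)) = sorted lt_ord r.
Proof.
rewrite rev_sorted sorted_map; apply: eq_sorted => p q /=.
by rewrite ltn_sub2lE // ltnS.
Qed.

Lemma word_omit_flip D :
  word_omit s flip_word D = (word_omit s b [set k | rev_ord k \in D])^-1.
Proof.
have ordsE : rev (map (@rev_ord l) ords) = ords.
  apply: eq_sorted_ord; rewrite ?sorted_flip ?sorted_ords // => k.
  by rewrite mem_rev mem_enum -[k]rev_ordK map_f ?mem_enum.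
rewrite !word_omitE /omit -{1}ordsE -map_rev big_map -[ords in RHS]revK -prodgV.
by apply: eq_big => k; rewrite ?inE // tnth_mktuple rev_ordK simple_reflV.
Qed.

Lemma saturated_chainV m v w c c' : (forall i, c' i = (c i)^-1) ->
  saturated_chain s m v w c -> saturated_chain s m v^-1 w^-1 c'.
Proof.
move=> c'E [<- cov <-]; split=> // i /cov; rewrite !c'E.
by case/andP=> le e; rewrite /bruhat_cover bleV //= /ell2 !ellV.
Qed.

Lemma prefix_omission_chain_flip m v w (k : m.-tuple 'I_l) :
  prefix_omission_chain s b v w k <->
  suffix_omission_chain s flip_word v^-1 w^-1 (flip k).
Proof.
have cE i : word_omit s flip_word [set p in drop i (flip k)] =
    (word_omit s b [set p in take (m - i) k])^-1.
  rewrite word_omit_flip; congr (word_omit s b _)^-1; apply/setP=> p.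
  rewrite !inE drop_rev size_map size_tuple mem_rev -map_take.
  exact: (mem_map rev_ord_inj).
rewrite /suffix_omission_chain sorted_flip.
split=> -[sk ch]; split=> //; first exact: saturated_chainV ch.
rewrite -[v]invgK -[w]invgK; apply: saturated_chainV ch => i.
by rewrite cE invgK.
Qed.

Lemma reduced_expression_flip w :
  reduced_expression s b w -> reduced_expression s flip_word w^-1.
Proof.
have omit0 b' : word_prod s b' = word_omit s b' set0.
  by apply: eq_bigl => k; rewrite inE.
case=> <- lE; split; last by rewrite ellV.
rewrite omit0 word_omit_flip omit0; congr (word_omit s b _)^-1.
by apply/setP=> k; rewrite !inE.
Qed.

Lemma prefix_chain_exists_unique v w m :
  reduced_expression s b w -> bruhat_le s v w -> m = ell2 s v w ->
  exists! k : m.-tuple 'I_l, prefix_omission_chain s b v w k.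
Proof.
move=> bw vw mE; have mE' : m = ell2 s v^-1 w^-1 by rewrite /ell2 !ellV.
have [j [jch j1]] :=
  suffix_chain_exists_unique (reduced_expression_flip bw) (bleV vw) mE'.
exists (flip j); split=> [|k /prefix_omission_chain_flip/j1->].
  by apply/prefix_omission_chain_flip; rewrite flipK.
exact: flipK.
Qed.

End Reversal.

Theorem corollary9p5 (W : finGroupType) (Delta : finType)
    (s : coxeterSystem W Delta) (v w : W) (hvw : bruhat_le s v w)
    (l : nat) (b : l.-tuple Delta) (hb : reduced_expression s b w)
    (m : nat) (hm : m = ell2 s v w) :
  (exists! j : m.-tuple 'I_l, suffix_omission_chain s b v w j) /\
  (exists! k : m.-tuple 'I_l, prefix_omission_chain s b v w k).
Proof.
split; first exact: suffix_chain_exists_unique.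
exact: prefix_chain_exists_unique.
Qed.
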